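(* Let $\boldsymbol d'$ and $w$ satisfy conditions (i)–(iii) of the context. Let $\Delta_{\max}$ be the maximum of the diameters (in graph distance) of the connected components of the configuration model $\mathrm{CM}_n(\boldsymbol d')$. Then, as $n\to\infty$, $$\mathbb{P}\big(\Delta_{\max}>n^{\delta}(\log n)^2\big)\to0.$$
   Context: Fix $\tau\in(3,4)$, $\alpha=1/(\tau-1)$, $\eta=(\tau-3)/(\tau-1)$. $\ell^p_\downarrow$ is the set of non-increasing nonnegative sequences with finite $\sum_i x_i^p$. For each $n$, $\boldsymbol d'=(d_1',\dots,d_n')$ is a non-increasing degree sequence with even sum and $w:[n]\to[0,\infty)$, $i\mapsto w_i$, is a weight function (both depend on $n$). Assumptions: (i) For each fixed $i$, $n^{-\alpha}d_i'\to c_i$ with $\boldsymbol c=(c_i)_{i\ge1}\in\ell^3_\downarrow\setminus\ell^2_\downarrow$. The degree of a uniform vertex converges in distribution to a positive integer-valued random variable $D'$, with $\frac1n\sum_i d_i'\to\mathbb{E}[D']$ and $\frac1n\sum_i d_i'^2\to\mathbb{E}[D'^2]$, and $\lim_{K\to\infty}\limsup_{n\to\infty}n^{-3\alpha}\sum_{i>K}d_i'^3=0$. Moreover $\frac1n\sum_i d_i'\to\mu_d$, $\frac1n\sum_i w_i\to\mu_w$, $\frac1n\sum_i d_i'w_i\to\mu_{d,w}$. (ii) $\max_i w_i=O(n^\alpha)$, $\sum_i w_i^2=O(n)$, and $\max\{\sum_i w_i^3,\sum_i d_i'^2w_i,\sum_i d_i'w_i^2\}=O(n^{3\alpha})$.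 (iii) There exist $0<\delta<\eta$ and $\lambda_0>0$ with $\nu_n':=\sum_i d_i'(d_i'-1)/\sum_i d_i'=1-\lambda_0n^{-\delta}+o(n^{-\delta})$. $\mathrm{CM}_n(\boldsymbol d')$ is the configuration model: vertex $i$ has $d_i'$ half-edges, and all half-edges are paired by a uniform perfect matching, each pair forming an edge. *)

(* Defs.v *)
From mathcomp Require Export all_boot all_order all_algebra.
From mathcomp Require Export all_classical all_reals all_analysis.
Export Order.TTheory GRing.Theory Num.Theory.
Export numFieldNormedType.Exports.

Set Implicit Arguments.
Unset Strict Implicit.
Unset Printing Implicit Defensive.

Local Open Scope ring_scope.

Section GraphDistance.
Variables (T : finType) (e : rel T).

(* Least number of edges of an e-path from u to v. A shortest path has fewer
   than #|T| edges, so the bounded search is complete when v is reachable from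
   u; otherwise the value is the junk #|T|, which diameter never uses below. *)
Definition gdist (u v : T) : nat :=
  find (fun k => [exists p : k.-tuple T, path e u p && (last u p == v)])
       (iota 0 #|T|).

Definition component (u : T) : {set T} := [set v | connect e u v].

Definition diameter (C : {set T}) : nat :=
  (\max_(u in C) \max_(v in C) gdist u v)%N.

Definition max_diameter : nat := (\max_(u : T) diameter (component u))%N.

End GraphDistance.

Definition perfect_matchings (H : finType) : {set {set {set H}}} :=
  [set M : {set {set H}} | finset.partition M [set: H]
                         & [forall B in M, #|B| == 2%N]].

Section ConfigurationModel.
Variables (n : nat) (d : nat -> nat).

(* Vertices are numbered from 0, so vertex i of the paper is i - 1 here, and
   the values d i with n <= i are irrelevant. *)
Definition half_edge : finType := {i : 'I_n & 'I_(d i)}.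

(* Loops and multiple edges are allowed but do not affect distances. *)
Definition cm_adj (M : {set {set half_edge}}) : rel 'I_n := fun u v =>
  [exists x : half_edge, exists y : half_edge,
    [&& tag x == u, tag y == v & [set x; y] \in M]].

(* Probability of A under a uniform perfect matching of the half-edges. *)
Definition cm_prob (R : realType) (A : pred {set {set half_edge}}) : R :=
  #|[set M in perfect_matchings half_edge | A M]|%:R
    / #|perfect_matchings half_edge|%:R.

End ConfigurationModel.

Local Open Scope classical_set_scope.

Section Conditions.
Variable R : realType.

Definition alpha (tau : R) : R := 1 / (tau - 1).
Definition eta (tau : R) : R := (tau - 3) / (tau - 1).

Definition ell_down (p : nat) : set (nat -> R) :=
  [set x | [/\ nonincreasing_seq x, (forall i, 0 <= x i)
             & (\sum_(0 <= i <oo) (x i ^+ p)%:E < +oo)%E]].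

Definition degree_sequence (n : nat) (d : nat -> nat) : Prop :=
  (forall i j, (i <= j < n)%N -> (d j <= d i)%N)
  /\ ~~ odd (\sum_(i < n) d i).

Definition degree_cdf (n : nat) (d : nat -> nat) (x : R) : R :=
  #|[set i : 'I_n | ((d i)%:R <= x)%R]%SET|%:R / n%:R.

Definition criticality (n : nat) (d : nat -> nat) : R :=
  (\sum_(i < n) (d i)%:R * ((d i)%:R - 1)) / (\sum_(i < n) (d i)%:R).

Section Sequences.
Variables (tau : R) (d : nat -> nat -> nat) (w : nat -> nat -> R).

Record condition_i (disp : measure_display) (T : measurableType disp)
    (P : probability T R) (D : {RV P >-> R}) (c : nat -> R)
    (mu_d mu_w mu_dw : R) : Prop := ConditionI {
  hubs : forall i,
    n%:R `^ (- alpha tau) * (d n i)%:R @[n --> \oo] --> c i;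
  hubs_limit : (ell_down 3 `\` ell_down 2) c;
  limit_degree_pos : forall t, exists2 k : nat, (0 < k)%N & D t = k%:R;
  (* convergence in distribution of the degree of a uniform vertex *)
  degree_cvg : forall x : R, {for x, continuous (cdf D)} ->
    (degree_cdf n (d n) x)%:E @[n --> \oo] --> cdf D x;
  degree_mean :
    (n%:R^-1 * \sum_(i < n) (d n i)%:R : R)%:E @[n --> \oo] --> ('E_P[D])%E;
  degree_second_moment :
    (n%:R^-1 * \sum_(i < n) (d n i)%:R ^+ 2 : R)%:E @[n --> \oo]
      --> ('E_P[fun t => (D t ^+ 2)%R])%E;
  degree_third_moment_tail :
    limn_esup (fun n => (n%:R `^ (- (3 * alpha tau))
                         * \sum_(K <= i < n) (d n i)%:R ^+ 3)%:E)
      @[K --> \oo] --> 0%E;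
  degree_mean_mu :
    n%:R^-1 * \sum_(i < n) (d n i)%:R @[n --> \oo] --> mu_d;
  weight_mean_mu : n%:R^-1 * \sum_(i < n) w n i @[n --> \oo] --> mu_w;
  degree_weight_mean_mu :
    n%:R^-1 * \sum_(i < n) (d n i)%:R * w n i @[n --> \oo] --> mu_dw
}.

Record condition_ii : Prop := ConditionII {
  weight_max :
    (fun n => \big[Num.max/0]_(i < n) w n i) =O_\oo
    (fun n => n%:R `^ alpha tau);
  weight_sq :
    (fun n => \sum_(i < n) w n i ^+ 2) =O_\oo (fun n => n%:R : R);
  weight_third :
    (fun n => Num.max (\sum_(i < n) w n i ^+ 3)
               (Num.max (\sum_(i < n) (d n i)%:R ^+ 2 * w n i)
                        (\sum_(i < n) (d n i)%:R * w n i ^+ 2))) =O_\oo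
    (fun n => n%:R `^ (3 * alpha tau))
}.

Record condition_iii (delta lambda0 : R) : Prop := ConditionIII {
  delta_range : 0 < delta < eta tau;
  lambda0_pos : 0 < lambda0;
  barely_subcritical :
    (fun n => criticality n (d n)) =
    (fun n => 1 - lambda0 * n%:R `^ (- delta)) +o_\oo
    (fun n => n%:R `^ (- delta))
}.

End Sequences.
End Conditions.

(* Main.v *)
(** A component of diameter greater than [m] contains a path with [m + 1] edges
    and distinct vertices.  Explore such a path half-edge by half-edge: given the
    pairs revealed so far, the current half-edge is equally likely to be matched
    with any of the at least [L - 2 m] free ones ([L] is the total degree), and
    one then leaves the vertex reached through another of its half-edges.  Each
    step thus costs a factor at most [L * nu / (L - 2 m)], and a union bound over
    the first half-edge bounds the probability by
    [L * (L * nu / (L - 2 m)) ^ m], which is at most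
    [L * exp (4 m^2 / L - lambda0 / 2 * n^(-delta) * m)] once
    [nu <= 1 - lambda0 / 2 * n^(-delta)].  For [m] about [n^delta * (ln n)^2]
    the first term of the exponent is bounded, because [delta < 1/2] and [L] is
    of order [n], while the second one is about [- lambda0 / 2 * (ln n)^2], so
    that the bound is [O(1/n)]. *)

Require Import Defs.
From mathcomp Require Import fingroup perm zify lra.

Set Implicit Arguments.
Unset Strict Implicit.
Unset Printing Implicit Defensive.

(** * Perfect matchings with some pairs already revealed *)

Section Matchings.
Variable H : finType.
Implicit Types (M S : {set {set H}}) (x y : H).

(** Relative to all perfect matchings, their number is the probability that every pair of [S] is
    present; conditioning on revealed pairs becomes comparing such cardinalities. *)
Definition extensions S : {set {set {set H}}} :=
  [set M in perfect_matchings H | S \subset M].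

Lemma perfect_matchingP M :
  reflect [/\ finset.cover M = [set: H], finset.trivIset M
            & {in M, forall B : {set H}, #|B| = 2%N}]
          (M \in perfect_matchings H).
Proof.
rewrite inE; apply: (iffP andP) => [[/and3P[/eqP cM tM _] /forall_inP cd]|].
  by split=> // B /cd/eqP.
case=> cM tM cd; split; last by apply/forall_inP => B /cd ->.
apply/and3P; split=> //; first exact/eqP.
by apply/negP => /cd; rewrite cards0.
Qed.

Lemma matching_block_eq M (B C : {set H}) x : M \in perfect_matchings H ->
  B \in M -> C \in M -> x \in B -> x \in C -> B = C.
Proof.
case/perfect_matchingP=> _ tM _ BM CM xB xC.
by rewrite -(def_pblock tM BM xB) (def_pblock tM CM xC).
Qed.

Lemma matching_neq M x y :
  M \in perfect_matchings H -> [set x; y] \in M -> x != y.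
Proof. by case/perfect_matchingP=> _ _ cd /cd; rewrite cards2; case: eqP. Qed.

Lemma matching_partner_unique M x y z : M \in perfect_matchings H ->
  [set x; y] \in M -> [set x; z] \in M -> y = z.
Proof.
move=> MP xy xz; have E : [set x; y] = [set x; z].
  by apply: (matching_block_eq (x := x) MP); rewrite ?set21.
have : y \in [set x; z] by rewrite -E set22.
rewrite in_set2 eq_sym (negbTE (matching_neq MP xy)) /=.
by move/eqP.
Qed.

Lemma notin_coverP S y : y \notin finset.cover S ->
  {in S, forall B : {set H}, y \notin B}.
Proof.
move=> yS B BS; apply: contraNN yS => yB.
by apply/bigcupP; exists B.
Qed.

Lemma imset_perfect_matching (f : {perm H}) M : M \in perfect_matchings H ->
  [set f @: (B : {set H}) | B in M] \in perfect_matchings H.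
Proof.
case/perfect_matchingP=> cM tM cd; apply/perfect_matchingP; split.
- rewrite cover_imset -imset_cover cM.
  apply/setP => z; rewrite finset.in_setT; apply/imsetP.
  by exists ((f^-1)%g z); rewrite ?finset.in_setT ?permKV.
- by rewrite imset_trivIset //; apply: perm_inj.
- by move=> _ /imsetP[B /cd cB ->]; rewrite card_imset //; apply: perm_inj.
Qed.

(* Transposing y and z is a bijection on matchings that fixes x and S. *)
Lemma card_extensions_swap S x y z :
  x \notin finset.cover S -> y \notin finset.cover S ->
  z \notin finset.cover S -> y != x -> z != x ->
  (#|extensions ([set x; y] |: S)| <= #|extensions ([set x; z] |: S)|)%N.
Proof.
move=> xS yS zS yx zx; pose f := tperm y z.
pose F (B : {set H}) := f @: B.
have Finj : injective F by apply: imset_inj; exact: perm_inj.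
rewrite -(card_imset _ (imset_inj Finj)); apply: subset_leq_card.
apply/fintype.subsetP => _ /imsetP[M + ->]; rewrite !inE !finset.subUset !finset.sub1set.
case/andP=> MP /andP[xyM SM].
rewrite [X in X && _](_ : _ = ([set F B | B in M] \in perfect_matchings H)); last first.
  by rewrite inE.
rewrite imset_perfect_matching ?inE//=; apply/andP; split.
  apply/imsetP; exists [set x; y] => //.
  by rewrite /F imsetU1 imset_set1 tpermL tpermD.
apply/fintype.subsetP => B BS; apply/imsetP; exists B; first exact: (fintype.subsetP SM).
have fB : {in B, f =1 id}.
  move=> t tB; apply: tpermD; apply: contraTneq tB => <-.
    exact: (notin_coverP yS).
  exact: (notin_coverP zS).
by rewrite /F (eq_in_imset fB) finset.imset_id.
Qed.

(* By symmetry all free half-edges are equally likely partners of x. *)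
Lemma card_extensions_step S x y : x \notin finset.cover S ->
  (#|extensions ([set x; y] |: S)| * (#|H| - #|finset.cover S| - 1)
     <= #|extensions S|)%N.
Proof.
(* Unless the left-hand side is 0, some matching contains [S] and the new pair, which forces [y] to
   be free and distinct from [x]. *)
move=> xS; have [->|[M]] := set_0Vmem (extensions ([set x; y] |: S)).
  by rewrite cards0.
rewrite inE finset.subUset finset.sub1set => /andP[MP /andP[xyM SM]].
have yx : y != x by rewrite eq_sym (matching_neq MP xyM).
have yS : y \notin finset.cover S.
  apply/bigcupP => -[B BS yB].
  have E : B = [set x; y].
    by apply: (matching_block_eq MP _ xyM yB); rewrite ?set22 ?(fintype.subsetP SM).
  by move: (notin_coverP xS BS); rewrite E set21.
have -> : (#|H| - #|finset.cover S| - 1 = #|~: (x |: finset.cover S)|)%N.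
  by have := cardsC (x |: finset.cover S); rewrite cardsU1 xS; lia.
(* Sum over the free [z] other than [x]: by the swap each term is at least the one for [y], and no
   matching is counted twice because [x] has a single partner. *)
rewrite mulnC -sum_nat_const.
apply: (@leq_trans (\sum_(z in ~: (x |: finset.cover S))
    #|extensions ([set x; z] |: S)|)%N).
  apply: leq_sum => z; rewrite !inE negb_or => /andP[zx zS].
  exact: card_extensions_swap.
pose c z := (fun M => nat_of_bool ([set x; z] \in M)).
have E z : #|extensions ([set x; z] |: S)| = (\sum_(M in extensions S) c z M)%N.
  rewrite -sum1_card big_mkcond [RHS]big_mkcond; apply: eq_bigr => N _.
  rewrite !inE finset.subUset finset.sub1set /c.
  by case: ([set x; z] \in N) => /=; rewrite ?andbF //; case: ifP.
rewrite (eq_bigr _ (fun z _ => E z)) exchange_big /= -sum1_card.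
apply: leq_sum => N; rewrite inE => /andP[NP _].
have [/existsP[z xz]|/existsPn no] := boolP [exists z, [set x; z] \in N].
  rewrite (bigID (pred1 z)) /= [X in (_ + X <= _)%N]big1 ?addn0; last first.
    move=> t /andP[_ tz]; rewrite /c; case: (boolP (_ \in N)) => // xt.
    by rewrite (matching_partner_unique NP xt xz) eqxx in tz.
  apply: (@leq_trans (\sum_(i | i == z) c i N)%N); last first.
    by rewrite big_pred1_eq /c; case: (_ \in N).
  rewrite [X in (X <= _)%N]big_mkcond [X in (_ <= X)%N]big_mkcond leq_sum // => t _.
  by case: (_ \in ~: _); case: (t == z).
by rewrite big1 // => t _; rewrite /c (negbTE (no t)).
Qed.

Lemma card_exists_leq (I T : finType) (P : I -> pred T) :
  (#|[set t | [exists i, P i t]]| <= \sum_i #|[set t | P i t]|)%N.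
Proof.
rewrite [X in #|pred_of_set X|](_ : _ = \bigcup_i [set t | P i t]); last first.
  apply/setP => t; rewrite inE; apply/existsP/bigcupP => [[i Pi]|[i _]].
    by exists i; rewrite ?inE.
  by rewrite inE; exists i.
elim/big_ind2: _ => [|m A n B Am Bn|//]; first by rewrite cards0.
by rewrite (leq_trans (leq_card_setU _ _)) ?leq_add.
Qed.

(** * Counting the matchings that admit a long exploration *)

Section Chains.
Variables (V : eqType) (v : H -> V).

(* S collects the pairs already revealed; they are carried along so that the
   walk never revisits a matched half-edge. *)
Fixpoint chain M m x S : bool :=
  if m is m'.+1 then
    [exists y, exists z, [&& v z == v y, z != y,
      z \notin finset.cover ([set x; y] |: S), [set x; y] \in M
      & chain M m' z ([set x; y] |: S)]]
  else true.

(** Counts the ways to enter a vertex by [y] and leave it by [z]; when [v] sends a half-edge to its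
    vertex this is the numerator of [criticality]. *)
Definition ordered_pairs : nat :=
  (\sum_y #|[set z | (v z == v y) && (z != y)]|)%N.

(** Induction on [m]: summing over the choices of [y] and [z] gives a factor [ordered_pairs], and
    revealing the pair costs [#|H| - K.*2]. The fixed [K] bounds the number of pairs ever revealed,
    so the same factor serves at each step. *)
Lemma card_chain K m x S :
  x \notin finset.cover S -> (#|finset.cover S| + m.*2 <= K.*2)%N ->
  (#|[set M in extensions S | chain M m x S]| * (#|H| - K.*2) ^ m
     <= ordered_pairs ^ m * #|extensions S|)%N.
Proof.
elim: m x S => [|m IH] x S xS hK.
  rewrite !expn0 muln1 mul1n; apply: subset_leq_card.
  by apply/fintype.subsetP => M; rewrite inE => /andP[].
(* The conditions of a step that do not involve [M]. *)
pose C y z := [&& v z == v y, z != y & z \notin finset.cover ([set x; y] |: S)].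
pose G y z := [set M in extensions ([set x; y] |: S)
                | C y z && chain M m z ([set x; y] |: S)].
have B1 : (#|[set M in extensions S | chain M m.+1 x S]| <=
           \sum_y \sum_z #|G y z|)%N.
  apply: (@leq_trans #|[set M | [exists y, [exists z, M \in G y z]]]|).
    apply: subset_leq_card; apply/fintype.subsetP => M; rewrite !inE /=.
    case/andP=> /andP[MP SM] /existsP[y /existsP[z /and5P[a b c e f]]].
    apply/existsP; exists y; apply/existsP; exists z.
    rewrite !inE MP finset.subUset finset.sub1set e SM /C a b f /= andbT.
    exact: c.
  apply: leq_trans (card_exists_leq _) _; apply: leq_sum => y _.
  apply: leq_trans (card_exists_leq _) _; apply: leq_sum => z _.
  by apply: subset_leq_card; apply/fintype.subsetP => M; rewrite inE.
have B2 y z : (#|G y z| * (#|H| - K.*2) ^ m.+1 <=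
    ((v z == v y) && (z != y)) * (ordered_pairs ^ m * #|extensions S|))%N.
  have [/and3P[a b c]|nC] := boolP (C y z); last first.
    rewrite [G y z](_ : _ = finset.set0) ?cards0 //.
    by apply/setP => M; rewrite !inE (negbTE nC) andbF.
  rewrite a b mul1n expnSr mulnA.
  have cU : (#|finset.cover ([set x; y] |: S)| <= #|finset.cover S| + 2)%N.
    rewrite /finset.cover finset.bigcup_setU big_set1.
    rewrite (leq_trans (leq_card_setU _ _)) // addnC leq_add2l cards2.
    by case: (_ != _).
  apply: (@leq_trans (ordered_pairs ^ m * #|extensions ([set x; y] |: S)|
     * (#|H| - K.*2))%N).
    rewrite leq_mul2r; apply/orP; right.
    apply: leq_trans (IH z _ c _); last by lia.
    rewrite leq_mul2r; apply/orP; right.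
    apply: subset_leq_card; apply/fintype.subsetP => M.
    by move=> /setIdP[ME /andP[_ cM]]; apply/setIdP.
  rewrite -mulnA leq_mul2l; apply/orP; right.
  (* A step remains, so [#|finset.cover S| + 2 <= K.*2] and at least [#|H| - K.*2] partners are
     available. *)
  apply: leq_trans (card_extensions_step y xS).
  rewrite leq_mul2l; apply/orP; right; lia.
apply: (@leq_trans ((\sum_y \sum_z #|G y z|) * (#|H| - K.*2) ^ m.+1)%N).
  by rewrite leq_mul2r B1 orbT.
rewrite (expnS ordered_pairs) -mulnA {1}/ordered_pairs !big_distrl /=.
apply: leq_sum => y _.
rewrite -[#|[set z | _]|]sum1_card [X in (_ <= X * _)%N]big_mkcond !big_distrl /=.
apply: leq_sum => z _; apply: leq_trans (B2 y z) _.
by rewrite inE; case: (_ && _).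
Qed.

Lemma card_exists_chain K m : (m <= K)%N ->
  (#|[set M in perfect_matchings H
      | [exists x, chain M m x finset.set0]]| * (#|H| - K.*2) ^ m
     <= #|H| * ordered_pairs ^ m * #|perfect_matchings H|)%N.
Proof.
move=> mK; have E0 : extensions finset.set0 = perfect_matchings H.
  by apply/setP => M; rewrite inE finset.sub0set andbT.
have c0 : finset.cover (finset.set0 : {set {set H}}) = finset.set0.
  by rewrite /finset.cover big_set0.
apply: (@leq_trans ((\sum_x #|[set M in extensions finset.set0
    | chain M m x finset.set0]|) * (#|H| - K.*2) ^ m)%N).
  rewrite leq_mul2r; apply/orP; right; rewrite E0.
  apply: leq_trans (card_exists_leq _); apply: subset_leq_card.
  apply/fintype.subsetP => M; rewrite inE => /andP[MP /existsP[x cx]].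
  by rewrite inE; apply/existsP; exists x; rewrite MP.
rewrite big_distrl /= -mulnA -[X in (_ <= X * _)%N]sum1_card big_distrl /=.
apply: leq_sum => x _; rewrite mul1n -E0; apply: card_chain.
  by rewrite c0 finset.in_set0.
by rewrite c0 cards0 add0n leq_double.
Qed.

End Chains.
End Matchings.

(** * From a large diameter to a chain of half-edges *)

Lemma gdist_leq (T : finType) (e : rel T) u p :
  path e u p -> (size p < #|T|)%N -> (gdist e u (last u p) <= size p)%N.
Proof.
move=> ep sp; rewrite /gdist leqNgt; apply/negP => /(before_find 0%N).
rewrite nth_iota // add0n => /existsP; case.
by exists (in_tuple p); rewrite ep /=.
Qed.

(** A simple path between vertices at distance at least [m] has at least [m] edges; its first [m]
    edges are kept. *)
Lemma max_diameter_path (T : finType) (e : rel T) m :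
  symmetric e -> (0 < m <= max_diameter e)%N ->
  exists u p, [/\ path e u p, uniq (u :: p) & size p = m].
Proof.
move=> esym /andP[m0 hm].
have [/existsP[u /existsP[v /andP[/connectP[p ep vp] md]]]|/existsPn no] :=
    boolP [exists u, exists v, connect e u v && (m <= gdist e u v)%N].
  move: md; rewrite vp; case: (shortenP ep) => q eq uq _ mq.
  exists u, (take m q); split.
  - by rewrite -(cat_take_drop m q) cat_path in eq; case/andP: eq.
  - by rewrite -[u :: _]/(take m.+1 (u :: q)) take_uniq.
  - rewrite size_takel // (leq_trans mq) // gdist_leq //.
    by rewrite (leq_trans _ (max_card (mem (u :: q)))) // (card_uniqP uq).
suff mm : (max_diameter e <= m.-1)%N.
  by have := leq_trans hm mm; rewrite leqNgt ltn_predL m0.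
rewrite /max_diameter /diameter.
apply/bigmax_leqP => a _; apply/bigmax_leqP => u au; apply/bigmax_leqP => v av.
rewrite -ltnS prednK // ltnNge; apply/negP => mg.
have /negP[] := no u; apply/existsP; exists v; rewrite mg andbT.
(* Both [u] and [v] are reachable from [a], so by symmetry [u] reaches [v] through [a]. *)
rewrite !inE in au av; apply: connect_trans av.
by rewrite (sym_connect_sym esym).
Qed.

Lemma cm_adj_sym n d (M : {set {set half_edge n d}}) : symmetric (cm_adj M).
Proof.
suff S u v : cm_adj M u v -> cm_adj M v u by move=> u v; apply/idP/idP; exact: S.
case/existsP=> x /existsP[y /and3P[xu yv xyM]].
by apply/existsP; exists y; apply/existsP; exists x; rewrite yv xu finset.setUC.
Qed.

(** The chain leaves each vertex by the half-edge of the next edge of the path. That half-edge is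
    free because the covered ones lie at vertices the path has left for good. *)
Lemma chain_of_path n d (M : {set {set half_edge n d}}) m :
  M \in perfect_matchings (half_edge n d) ->
  forall (x y : half_edge n d) (p : seq 'I_n) (S : {set {set half_edge n d}}),
  [set x; y] \in M -> uniq [:: tag x, tag y & p] ->
  path (cm_adj M) (tag y) p ->
  {in finset.cover S, forall z, tag z \notin tag y :: p} ->
  (m <= size p)%N ->
  chain (fun z : half_edge n d => tag z) M m x S.
Proof.
move=> MP; elim: m => [//|m IH] x y [//|w q] S xyM.
rewrite /= !in_cons !negb_or -!andbA.
case/and5P=> xy xw xq yw /and3P[yq wq uq] /andP[/existsP[z /existsP[z']]].
case/and3P=> /eqP zy /eqP z'w zz' pq covS sz.
apply/existsP; exists y; apply/existsP; exists z.
have nzy : z != y.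
  (* If [z = y], then [z'] is the partner [x] of [y], and the path returns to the vertex of [x]. *)
  apply: contraNneq xw => E; rewrite E in zz'.
  rewrite finset.setUC in xyM.
  by rewrite (matching_partner_unique MP xyM zz') z'w.
have nzx : z != x by apply: contraNneq xy => <-; rewrite zy.
have cov : finset.cover ([set x; y] |: S) = [set x; y] :|: finset.cover S.
  by rewrite /finset.cover finset.bigcup_setU big_set1.
rewrite zy eqxx nzy xyM cov !inE (negbTE nzx) (negbTE nzy) /=.
apply/andP; split.
  by apply/negP => /covS; rewrite zy in_cons eqxx.
apply: (IH z z' q) => //; first by rewrite /= zy z'w in_cons negb_or yw yq wq.
  by rewrite z'w.
move=> t; rewrite cov !inE z'w => /orP[/orP[]/eqP->|/covS].
- by rewrite negb_or xw.
- by rewrite negb_or yw.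
- by rewrite in_cons negb_or => /andP[].
Qed.

(** * Counting in the configuration model *)

Lemma card_half_edge n d : #|half_edge n d| = (\sum_(i < n) d i)%N.
Proof.
by rewrite card_tagged sumnE big_map big_enum; apply: eq_bigr => i _; rewrite card_ord.
Qed.

Lemma ordered_pairs_half_edge n d :
  ordered_pairs (fun z : half_edge n d => tag z) = (\sum_(i < n) d i * (d i).-1)%N.
Proof.
rewrite /ordered_pairs.
have T (F : 'I_n -> nat) :
    (\sum_(z : half_edge n d) F (tag z) = \sum_(i < n) d i * F i)%N.
  rewrite -(@sig_big_dep _ _ _ _ (fun i : 'I_n => 'I_(d i)) xpredT
    (fun _ => xpredT) (fun i _ => F i)).
  by apply: eq_bigr => i _; rewrite sum_nat_const card_ord.
rewrite -(T (fun i => (d i).-1)); apply: eq_bigr => y _.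
have -> : [set z : half_edge n d | (tag z == tag y) && (z != y)]
    = [set z : half_edge n d | tag z == tag y] :\ y.
  by apply/setP => z; rewrite !inE andbC.
have : #|[set z : half_edge n d | tag z == tag y]| = d (tag y).
  rewrite cardsE -sum1_card big_mkcond (T (fun i => (i == tag y) : nat)).
  rewrite (bigD1 (tag y)) //= eqxx muln1 big1 ?addn0 // => i /negbTE ->.
  by rewrite muln0.
by rewrite (cardsD1 y) inE eqxx => <-.
Qed.

Lemma card_long_diameter n d m (h := #|half_edge n d|) :
  (#|[set M in perfect_matchings (half_edge n d)
      | (m < max_diameter (cm_adj M))%N]| * (h - m.*2) ^ m
   <= h * (\sum_(i < n) d i * (d i).-1) ^ m
        * #|perfect_matchings (half_edge n d)|)%N.
Proof.
rewrite -ordered_pairs_half_edge /h.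
apply: leq_trans (card_exists_chain _ (leqnn m)).
rewrite leq_mul2r; apply/orP; right.
apply: subset_leq_card; apply/fintype.subsetP => M /setIdP[MP mM].
apply/setIdP; split=> //.
(* A path with [m.+1] edges has [m] inner vertices, hence [m] steps: the last edge only supplies the
   half-edge leaving the last inner vertex. *)
have [u [p [+ + sp]]] := max_diameter_path (m := m.+1) (@cm_adj_sym n d M) mM.
case: p sp => [//|w q] [sq] /= /andP[/existsP[x /existsP[y]]].
case/and3P=> /eqP <- /eqP <- xyM pq uq.
apply/existsP; exists x; apply: (chain_of_path MP xyM uq pq); last by rewrite sq.
by move=> z; rewrite /finset.cover big_set0 inE.
Qed.

(** * Real-valued bounds on the probability *)

Local Open Scope ring_scope.

Lemma cm_prob_le_mono (R : realType) n d
    (A B : pred {set {set half_edge n d}}) :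
  (forall M, A M -> B M) -> cm_prob R A <= cm_prob R B.
Proof.
move=> AB; rewrite /cm_prob ler_wpM2r ?invr_ge0 ?ler0n // ler_nat.
apply: subset_leq_card; apply/fintype.subsetP => M /setIdP[MP AM].
by apply/setIdP; split=> //; exact: AB.
Qed.

Lemma cm_prob_long_diameter (R : realType) n (d : nat -> nat) m :
  let L : R := \sum_(i < n) (d i)%:R in
  m.*2%:R < L ->
  cm_prob R (fun M : {set {set half_edge n d}} =>
               (m < max_diameter (cm_adj M))%N)
  <= L * (criticality R n d * L / (L - m.*2%:R)) ^+ m.
Proof.
move=> L mL.
have hL : (#|half_edge n d|%:R : R) = L by rewrite card_half_edge natr_sum.
have L0 : 0 < L by apply: le_lt_trans mL; rewrite ler0n.
have Lm0 : 0 < L - m.*2%:R by rewrite subr_gt0.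
(* The natural [.-1] and the real [- 1] differ only at degree 0, where the other factor vanishes. *)
have QL : criticality R n d * L = (\sum_(i < n) d i * (d i).-1)%:R.
  rewrite /criticality divfK ?gt_eqF // natr_sum; apply: eq_bigr => i _.
  by case: (d i) => [|k]; rewrite ?mul0r ?mul0n // natrM //= -natr1 addrK.
rewrite /cm_prob QL; set p := #|perfect_matchings _|.
(* With no perfect matching, [cm_prob] is a division by 0, hence 0 by convention. *)
have [->|p0] := posnP p.
  rewrite invr0 mulr0 mulr_ge0 ?(ltW L0) // exprn_ge0 // divr_ge0 ?ler0n //.
  exact: ltW.
rewrite ler_pdivrMr ?ltr0n // expr_div_n mulrA mulrAC ler_pdivlMr ?exprn_gt0 //.
have := card_long_diameter n d m; cbv zeta; rewrite -/p -(ler_nat R) !natrM !natrX hL.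
rewrite natrB ?hL //.
by rewrite -(ler_nat R) hL ltW.
Qed.

(** With [t = 2m / L <= 1/2], one has [1 / (1 - t) <= 1 + 2t <= expR (2t)] and
    [nu <= 1 - b <= expR (- b)]; then raise to the power [m]. *)
Lemma subcritical_power_le (R : realType) (b L nu : R) m :
  0 < L -> 0 <= nu -> nu <= 1 - b -> 4 * m%:R <= L ->
  (nu * L / (L - m.*2%:R)) ^+ m <= expR (4 * m%:R ^+ 2 / L - b * m%:R).
Proof.
move=> L0 nu0 nub mL.
have m2 : m.*2%:R = 2 * m%:R :> R by rewrite -mul2n natrM.
have m0 : 0 <= m%:R :> R by rewrite ler0n.
set t := 2 * m%:R / L.
have t2 : 2 * t <= 1 by rewrite /t mulrA ler_pdivrMr //; lra.
have t0 : 0 <= t by apply: divr_ge0; [exact: mulr_ge0 | exact: ltW].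
have Lt : L - m.*2%:R = L * (1 - t).
  by rewrite m2 /t mulrBr mulr1 mulrCA divff ?gt_eqF // mulr1.
have E : nu * L / (L - m.*2%:R) = nu / (1 - t).
  by rewrite Lt [nu * L]mulrC -mulf_div divff ?mul1r // gt_eqF.
have F : nu / (1 - t) <= expR (2 * t - b).
  rewrite ler_pdivrMr; last lra.
  rewrite expRD.
  have e1 := expR_ge1Dx (2 * t); have e2 := expR_ge1Dx (- b).
  apply: (@le_trans _ _ (expR (- b))); first lra.
  rewrite mulrAC ler_peMl ?expR_ge0 //; nra.
rewrite E.
have -> : 4 * m%:R ^+ 2 / L - b * m%:R = (2 * t - b) * m%:R.
  by rewrite /t expr2; set v := L^-1; lra.
rewrite expRM_natr.
apply: lerXn2r; rewrite ?nnegrE ?expR_ge0 ?divr_ge0 //; lra.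
Qed.

Lemma expectation_ge1 (R : realType) (disp : measure_display) (T : measurableType disp)
    (P : probability T R) (X : {RV P >-> R}) :
  (forall t, 1 <= X t) -> (1 <= 'E_P[X])%E.
Proof.
move=> X1; rewrite -(expectation_cst P 1); apply: expectation_le => //.
- by move=> t; exact: le_trans (X1 t).
- by apply: aeW => t; exact: X1.
Qed.

(** * Asymptotics in [n] and conclusion *)

Local Open Scope classical_set_scope.

Lemma near_ln_ge (R : realType) (A : R) : \forall n \near \oo, A <= ln n%:R :> R.
Proof.
have := @cvgr_idn R => /cvgryPge /(_ (expR A)); apply: filterS => n An.
by rewrite -[A]expRK ler_ln ?posrE ?expR_gt0 // (lt_le_trans (expR_gt0 A)).
Qed.

(* 960 = 8 * 5!: only the term of degree 5 of the exponential series is used. *)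
Lemma near_ln_pow4_le (R : realType) (s : R) : 0 < s ->
  \forall n \near \oo, 8 * ln n%:R ^+ 4 <= expR (s * ln n%:R) :> R.
Proof.
move=> s0; have := near_ln_ge (960 / s ^+ 5); apply: filterS => n.
set u := ln _; rewrite ler_pdivrMr ?exprn_gt0 // => su.
have u0 : 0 <= u.
  have s5 : 0 < s ^+ 5 by rewrite exprn_gt0.
  have := le_trans (ler0n R 960) su.
  by rewrite (pmulr_lge0 _ s5).
have /(expR_ge1Dxn 4) := mulr_ge0 (ltW s0) u0.
rewrite (_ : 5`! = 120)%N // => /(le_trans _); apply.
have u4 : 0 <= u ^+ 4 by rewrite exprn_ge0.
have : 960 * u ^+ 4 <= (s * u) ^+ 5.
  rewrite exprMn (exprS u 4) mulrA (mulrC (s ^+ 5)); nra.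
lra.
Qed.

(** Half of [lambda0] absorbs the little-o error. *)
Lemma near_criticality_le (R : realType) (d : nat -> nat -> nat)
    (delta lambda0 : R) : 0 < lambda0 ->
  (fun n => criticality R n (d n)) =
    (fun n => 1 - lambda0 * n%:R `^ (- delta)) +o_\oo
    (fun n => n%:R `^ (- delta)) ->
  \forall n \near \oo,
    criticality R n (d n) <= 1 - lambda0 / 2 * n%:R `^ (- delta).
Proof.
move=> l0 /eqaddoE/eqaddoP/(_ (lambda0 / 2)); rewrite divr_gt0 // => /(_ isT).
apply: filterS => n /=; rewrite !fctE (ger0_norm (powR_ge0 _ _)).
by move=> /(le_trans (ler_norm _)); lra.
Qed.

(** The estimate for a single [n]: every limit is replaced by an explicit inequality that holds for
    large [n]. *)
Lemma long_diameter_bound (R : realType) (n : nat) (d : nat -> nat)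
    (delta lambda0 B : R) (u := ln n%:R : R) :
  0 < delta < 1 / 2 -> 0 < lambda0 ->
  criticality R n d <= 1 - lambda0 / 2 * n%:R `^ (- delta) ->
  (1 / 2 : R) <= n%:R^-1 * \sum_(i < n) (d i)%:R <= B ->
  4 / lambda0 <= u -> 1 <= u ->
  8 * u ^+ 4 <= expR ((1 - 2 * delta) * u) ->
  cm_prob R (fun M : {set {set half_edge n d}} =>
               n%:R `^ delta * u ^+ 2 < (max_diameter (cm_adj M))%:R)
    <= B * expR (1 + lambda0 / 2) * n%:R^-1.
Proof.
move=> /andP[d0 d1] l0 crit /andP[L1 LB] ul u1 u4.
(* Since [ln 0] is 0 by convention, [1 <= u] excludes [n = 0]. *)
have n0 : 0 < n%:R :> R.
  rewrite ltr0n lt0n; apply: contraTneq u1 => n0.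
  by rewrite /u n0 ln0 // -ltNge ltr01.
set N := n%:R in n0 L1 LB crit *.
have Nu : N = expR u by rewrite /u lnK ?posrE.
have powN s : N `^ s = expR (s * u) by rewrite /powR gt_eqF.
rewrite !powN in crit *.
set L := \sum_(i < n) (d i)%:R in L1 LB.
have L1' : N / 2 <= L by move: L1; rewrite [N^-1 * _]mulrC ler_pdivlMr //; lra.
have LB' : L <= B * N by move: LB; rewrite [N^-1 * _]mulrC ler_pdivrMr.
have L0 : 0 < L by apply: lt_le_trans L1'; lra.
set x := expR (delta * u) * u ^+ 2.
have x0 : 0 <= x by rewrite mulr_ge0 ?expR_ge0 ?exprn_ge0 //; lra.
(* Rounding down is safe: exceeding the threshold [x] implies exceeding [m]. *)
set m := Num.trunc x.
have /andP[mx xm] := truncn_itv x0; rewrite -/m in mx xm.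
have m0 : 0 <= m%:R :> R by rewrite ler0n.
(* The growth hypothesis on [u ^+ 4] serves here; it yields [4 * m%:R ^+ 2 <= N / 2 <= L]. *)
have x2 : 8 * x ^+ 2 <= N.
  rewrite /x exprMn -expRM_natr -exprM Nu.
  have -> : expR u = expR (delta * u * 2) * expR ((1 - 2 * delta) * u).
    by rewrite -expRD; congr expR; lra.
  by rewrite mulrCA ler_wpM2l ?expR_ge0.
have m2 : 8 * m%:R ^+ 2 <= N by apply: le_trans x2; nra.
have mN : 8 * m%:R <= N.
  apply: le_trans m2; rewrite ler_pM2l //.
  by case: (m) => [|k]; rewrite -natrX ler_nat // leq_pmulr.
have mL : 4 * m%:R <= L by lra.
have mL2 : m.*2%:R < L by rewrite -mul2n natrM; lra.
have nu0 : 0 <= criticality R n d.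
  rewrite /criticality divr_ge0 ?(ltW L0) // sumr_ge0 // => i _.
  by case: (d i) => [|k]; rewrite ?mul0r // mulr_ge0 // -natr1 addrK.
apply: le_trans (@cm_prob_le_mono _ _ _ _
    (fun M => m < max_diameter (cm_adj M))%N _) _.
  by move=> M /= /(le_lt_trans mx); rewrite ltr_nat.
apply: le_trans (cm_prob_long_diameter mL2) _.
(* In the constant, 1 bounds [4 * m%:R ^+ 2 / L], and [lambda0 / 2] pays for replacing [x] by
   [m]. *)
apply: (@le_trans _ _ (L * expR (1 + lambda0 / 2 - lambda0 / 2 * u ^+ 2))).
  rewrite ler_wpM2l ?(ltW L0) //.
  apply: le_trans (subcritical_power_le L0 nu0 crit mL) _; rewrite ler_expR.
  have A1 : 4 * m%:R ^+ 2 / L <= 1 by rewrite ler_pdivrMr //; lra.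
  set e := expR (- delta * u) in crit *.
  have e1 : e <= 1 by rewrite -[X in _ <= X]expR0 ler_expR; nra.
  have e0 : 0 <= e by rewrite expR_ge0.
  have A2 : e * x = u ^+ 2.
    by rewrite /x mulrA -expRD mulNr addNr expR0 mul1r.
  have A3 : u ^+ 2 - 1 <= e * m%:R.
    have : e * x <= e * (m%:R + 1) by rewrite ler_wpM2l // natr1 ltW.
    by rewrite A2 mulrDr; lra.
  have : lambda0 / 2 * (u ^+ 2 - 1) <= lambda0 / 2 * (e * m%:R).
    by rewrite ler_wpM2l //; lra.
  lra.
apply: (@le_trans _ _ (B * N * expR (1 + lambda0 / 2 - lambda0 / 2 * u ^+ 2))).
  by rewrite ler_wpM2r ?expR_ge0.
have B0 : 0 <= B by nra.
rewrite -!mulrA ler_wpM2l // Nu -expRN -!expRD ler_expR.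
(* Hence [lambda0 / 2 * u ^+ 2 >= 2 * u]: this cancels the factor [N] and leaves [N^-1]. *)
have : 4 <= u * lambda0 by rewrite -ler_pdivrMr.
nra.
Qed.

Theorem theorem2p4 (R : realType) (tau : R) (htau : 3 < tau < 4)
  (d : nat -> nat -> nat) (w : nat -> nat -> R)
  (hd : forall n, (0 < n)%N -> degree_sequence n (d n))
  (hw : forall n i, (i < n)%N -> 0 <= w n i)
  (disp : measure_display) (T : measurableType disp) (P : probability T R)
  (D : {RV P >-> R}) (c : nat -> R) (mu_d mu_w mu_dw : R)
  (hi : condition_i tau d w D c mu_d mu_w mu_dw)
  (hii : condition_ii tau d w)
  (delta lambda0 : R)
  (hiii : condition_iii tau d delta lambda0) :
  cm_prob R (fun M : {set {set half_edge n (d n)}} =>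
               n%:R `^ delta * ln n%:R ^+ 2 < (max_diameter (cm_adj M))%:R)
    @[n --> \oo] --> 0.
Proof.
case: hiii => /andP[delta0 delta_eta] lambda0_gt0 crit.
(* [eta tau <= 1/2] amounts to [tau <= 5]. *)
have delta_half : 0 < delta < 1 / 2.
  rewrite delta0 (lt_le_trans delta_eta) // /eta ler_pdivrMr; lra.
have mean_cvg := degree_mean_mu hi.
(* The mean degree also converges to the expectation of [D], which takes positive integer values; so
   the total degree is of order [n]. *)
have mu1 : 1 <= mu_d.
  rewrite -lee_fin (cvg_unique _ (cvg_EFin _ mean_cvg) (degree_mean hi)) //.
    apply: expectation_ge1 => t; have [k k0 ->] := limit_degree_pos hi t.
    by rewrite ler1n.
  by near=> n.
pose C : R := (mu_d + 1) * expR (1 + lambda0 / 2).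
have C0 : C * n%:R^-1 @[n --> \oo] --> 0.
  rewrite -[X in _ --> X](mulr0 C); apply: cvgM; first exact: cvg_cst.
  apply: (gtr0_cvgV0 _).2; last exact: cvgr_idn.
  by near=> n; rewrite ltr0n; near: n; exists 1%N.
apply: (squeeze_cvgr _ (cvg_cst 0) C0).
near=> n.
rewrite /cm_prob divr_ge0 ?ler0n //=.
apply: long_diameter_bound => //.
- near: n; exact: near_criticality_le.
- apply/andP; split; near: n.
    apply: filterS (cvgr_gt _ mean_cvg (1 / 2) _); last lra.
    by move=> n /ltW.
  apply: filterS (cvgr_lt _ mean_cvg (mu_d + 1) _); last lra.
  by move=> n /ltW.
- near: n; exact: near_ln_ge.
- near: n; exact: near_ln_ge.
- near: n; apply: near_ln_pow4_le; lra.
Unshelve. all: by end_near.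
Qed.
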